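(* Let $E$ be an arbitrary directed graph, $K$ a field, $L=L_K(E)$ and let $p$ be an infinite irrational path in $E$. Then the following properties are equivalent: (i) The Chen simple left $L$-module $V_{[p]}$ is finitely presented; (ii) $V_{[p]}$ is a projective left $L$-module; (iii) The path $p$ contains a vertex which is a line point.
   Context: A directed graph $E=(E^0,E^1,r,s)$ has vertex set $E^0$, edge set $E^1$ and range/source maps $r,s$; no cardinality restriction is made. A vertex is regular if it emits a nonempty finite set of edges. $L_K(E)$ is the (not necessarily unital) $K$-algebra generated by pairwise orthogonal idempotents $v\in E^0$ and elements $e,e^*$ ($e\in E^1$) subject to: $s(e)e=e=er(e)$; $r(e)e^*=e^*=e^*s(e)$; $e^*e=r(e)$ and $e^*f=0$ for $e\ne f$; $v=\sum_{s(e)=v}ee^*$ for each regular vertex $v$. Since $L$ need not have an identity, left $L$-modules $M$ are understood to satisfy $LM=M$. A module is finitely presented if it is isomorphic to $P/N$ with $P$ a finitely generated projective module and $N$ finitely generated. An infinite path is a sequence $p=e_1e_2e_3\cdots$ of edges with $r(e_i)=s(e_{i+1})$; $\tau^{>n}(p)=e_{n+1}e_{n+2}\cdots$. Infinite paths $p,q$ are tail-equivalent if $\tau^{>m}(p)=\tau^{>n}(q)$ for some positive integers $m,n$; $[p]$ is the tail-equivalence class of $p$. An infinite path is rational if it is tail-equivalent to $ccc\cdots$ for some closed path $c$ (a path of positive length with equal source and range), and irrational otherwise. $V_{[p]}$ is the $K$-vector space with basis $[p]$, with left $L$-action determined, for $q\in[p]$, $v\in E^0$, $e\in E^1$, by: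 $v\cdot q=q$ if $s(q)=v$ and $0$ otherwise; $e\cdot q=eq$ if $s(q)=r(e)$ and $0$ otherwise; $e^*\cdot q=q'$ if $q=eq'$ and $0$ otherwise. (It is known to be a simple $L$-module.) For a vertex $v$, $T_E(v)$ is the set of vertices $w$ such that there is a (possibly length $0$) path from $v$ to $w$. A bifurcation vertex is a vertex emitting more than one edge. A cycle is a closed path $e_1\cdots e_n$ with $s(e_i)\ne s(e_j)$ for $i\neq j$. A vertex $v$ is a line point if no vertex of $T_E(v)$ is a bifurcation vertex or the base of a cycle. *)

(* Defs.v *)
From HB Require Import structures.
From mathcomp Require Import all_boot all_algebra.
From mathcomp Require Import finmap boolp classical_sets cardinality.
From mathcomp Require Import freeg.

Set Implicit Arguments.
Unset Strict Implicit.
Unset Printing Implicit Defensive.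

Import GRing.Theory.

Local Open Scope ring_scope.
Local Open Scope classical_set_scope.
Local Open Scope quotient_scope.

(* Associative rings, not necessarily with an identity. *)
HB.mixin Record Zmodule_isRng R of GRing.Zmodule R := {
  rngmul : R -> R -> R;
  rngmulA : associative rngmul;
  rngmulDl : left_distributive rngmul +%R;
  rngmulDr : right_distributive rngmul +%R
}.

#[short(type="rngType")]
HB.structure Definition Rng := {R of GRing.Zmodule R & Zmodule_isRng R}.

(* [act_full] is the condition [R M = M], where [R M] is the set of finite
   sums of elements [act a x]. *)
HB.mixin Record Zmodule_isUmodule (R : rngType) M of GRing.Zmodule M := {
  act : R -> M -> M;
  actA : forall a b x, act (rngmul a b) x = act a (act b x);
  actDl : forall a b x, act (a + b) x = act a x + act b x;
  actDr : forall a x y, act a (x + y) = act a x + act a y;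
  act_full : forall x, exists (n : nat) (a : 'I_n -> R) (y : 'I_n -> M),
    x = \sum_(i < n) act (a i) (y i)
}.

#[short(type="umodType")]
HB.structure Definition Umodule (R : rngType) :=
  {M of GRing.Zmodule M & Zmodule_isUmodule R M}.

HB.mixin Record isActClosed (R : rngType) (M : umodType R) (N : M -> bool) := {
  act_closed : forall (a : R) (x : M), x \in N -> act a x \in N
}.

#[short(type="usubmod")]
HB.structure Definition Usubmod (R : rngType) (M : umodType R) :=
  {N of GRing.ZmodClosed M N & isActClosed R M N}.

Section QuotientModule.
Variables (R : rngType) (M : umodType R) (N : usubmod M).

Lemma act0r (a : R) : act a (0 : M) = 0.
Proof. by apply: (@addrI _ (act a 0)); rewrite -actDr !addr0. Qed.

Lemma actNr (a : R) (x : M) : act a (- x) = - act a x.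
Proof. by apply: (@addrI _ (act a x)); rewrite -actDr !subrr act0r. Qed.

Lemma act_sumr (a : R) n (x : 'I_n -> M) :
  act a (\sum_i x i) = \sum_i act a (x i).
Proof. exact: (big_morph (act a) (actDr a) (act0r a)). Qed.

Definition quotmod := Quotient.quot N.
HB.instance Definition _ := GRing.Zmodule.on quotmod.

Definition quot_proj (x : M) : quotmod := \pi_(Quotient.quot N) x.

Definition quot_repr (x : quotmod) : M := repr (x : Quotient.quot N).

Lemma quot_reprK : cancel quot_repr quot_proj.
Proof. exact: reprK. Qed.

Lemma quot_projP (x y : M) :
  quot_proj x = quot_proj y <-> (x - y \in (N : {pred M})).
Proof. by rewrite Quotient.idealrBE; split=> /eqP. Qed.

Lemma quot_projD (x y : M) : quot_proj (x + y) = quot_proj x + quot_proj y.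
Proof. exact: (raddfD (\pi_(Quotient.quot N))). Qed.

Lemma quot_proj_sum n (x : 'I_n -> M) :
  quot_proj (\sum_i x i) = \sum_i quot_proj (x i).
Proof. exact: (raddf_sum (\pi_(Quotient.quot N))). Qed.

Definition quot_act (a : R) (x : quotmod) : quotmod :=
  quot_proj (act a (quot_repr x)).

Lemma quot_actE (a : R) (x : M) :
  quot_act a (quot_proj x) = quot_proj (act a x).
Proof.
apply/quot_projP; rewrite -actNr -actDr; apply: act_closed.
by apply/quot_projP; rewrite quot_reprK.
Qed.

Fact quot_actA a b x : quot_act (rngmul a b) x = quot_act a (quot_act b x).
Proof. by rewrite -[x]quot_reprK !quot_actE actA. Qed.

Fact quot_actDl a b x : quot_act (a + b) x = quot_act a x + quot_act b x.
Proof. by rewrite -[x]quot_reprK !quot_actE actDl quot_projD. Qed.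

Fact quot_actDr a x y : quot_act a (x + y) = quot_act a x + quot_act a y.
Proof.
rewrite -[x]quot_reprK -[y]quot_reprK -quot_projD !quot_actE actDr.
by rewrite quot_projD.
Qed.

Fact quot_act_full x : exists (n : nat) (a : 'I_n -> R) (y : 'I_n -> quotmod),
  x = \sum_(i < n) quot_act (a i) (y i).
Proof.
have [n [a [y e]]] := act_full (R := R) (quot_repr x).
exists n, a, (fun i => quot_proj (y i)).
rewrite -[LHS]quot_reprK e quot_proj_sum.
by apply: eq_bigr => i _; rewrite quot_actE.
Qed.

HB.instance Definition _ := Zmodule_isUmodule.Build R quotmod
  quot_actA quot_actDl quot_actDr quot_act_full.

End QuotientModule.

Section ModuleProperties.
Variable R : rngType.
Implicit Types M P : umodType R.

Definition is_hom M P (f : M -> P) : Prop :=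
  (forall x y, f (x + y) = f x + f y) /\ (forall (a : R) x, f (act a x) = act a (f x)).

Definition isomorphic M P : Prop := exists f : M -> P, is_hom f /\ bijective f.

Definition projective P : Prop :=
  forall (M M' : umodType R) (g : M -> M') (f : P -> M'),
    is_hom g -> (forall y, exists x, g x = y) -> is_hom f ->
    exists h : P -> M, is_hom h /\ forall x, g (h x) = f x.

(* Since [R M = M], being generated by the [x i] as an R-module amounts to
   [M = R x_1 + ... + R x_n] as soon as R has local units. *)
Definition finitely_generated M : Prop :=
  exists (n : nat) (x : 'I_n -> M), forall y,
    exists a : 'I_n -> R, y = \sum_(i < n) act (a i) (x i).

Definition finitely_generated_sub M (N : usubmod M) : Prop :=
  exists (n : nat) (x : 'I_n -> M), (forall i, x i \in (N : {pred M})) /\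
    forall y, y \in (N : {pred M}) ->
    exists a : 'I_n -> R, y = \sum_(i < n) act (a i) (x i).

Definition finitely_presented M : Prop :=
  exists (P : umodType R) (N : usubmod P),
    [/\ finitely_generated P, projective P, finitely_generated_sub N
      & isomorphic M (quotmod N)].

End ModuleProperties.

Record digraph := Digraph {
  vertex : Type;
  edge : Type;
  esource : edge -> vertex;
  erange : edge -> vertex
}.

HB.instance Definition _ (E : digraph) := gen_eqMixin (vertex E).
HB.instance Definition _ (E : digraph) := gen_choiceMixin (vertex E).
HB.instance Definition _ (E : digraph) := gen_eqMixin (edge E).
HB.instance Definition _ (E : digraph) := gen_choiceMixin (edge E).

Section Graphs.
Variable E : digraph.
Implicit Types (v w : vertex E) (e : edge E) (c : seq (edge E)).
Implicit Types p q : nat -> edge E.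

Definition out_edges v : set (edge E) := [set e | esource e = v].

Definition regular v : Prop := finite_set (out_edges v) /\ out_edges v !=set0.

Definition bifurcation v : Prop :=
  exists e f, [/\ out_edges v e, out_edges v f & e <> f].

Fixpoint is_path v c w : Prop :=
  if c is e :: c' then esource e = v /\ is_path (erange e) c' w else v = w.

Definition tree v : set (vertex E) := [set w | exists c, is_path v c w].

(* Closed paths and cycles based at [v]; every vertex of a cycle is the base of
   one of its rotations. *)
Definition closed_path v c : Prop := c <> [::] /\ is_path v c v.

Definition graph_cycle v c : Prop :=
  closed_path v c /\ uniq [seq esource e | e <- c].

Definition line_point v : Prop :=
  forall w, tree v w -> ~ bifurcation w /\ ~ (exists c, graph_cycle w c).

(* The infinite path [e_1 e_2 e_3 ...] is the function [i |-> e_(i+1)], so that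
   [tail n p] is [tau^(>n)(p)]. *)
Definition infinite_path p : Prop := forall i, erange (p i) = esource (p i.+1).

Definition tail n p : nat -> edge E := fun i => p (n + i)%N.

Definition tail_equiv p q : Prop :=
  exists m n, [/\ (0 < m)%N, (0 < n)%N & tail m p =1 tail n q].

(* [c c c ...] for the nonempty sequence [c = e :: c'] *)
Definition repeat_path e c' : nat -> edge E :=
  fun i => nth e (e :: c') (i %% size (e :: c'))%N.

Definition rational p : Prop :=
  exists v e c', closed_path v (e :: c') /\ tail_equiv p (repeat_path e c').

Definition tail_class p : set (nat -> edge E) :=
  [set q | infinite_path q /\ tail_equiv p q].

Definition tail_path p : Type := set_type (tail_class p).

HB.instance Definition _ p := SubChoice.on (tail_path p).

End Graphs.

(* The Leavitt path algebra [leavitt K E] is the set of expressions in the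
   generators [v], [e] and [e^*] modulo the least congruence [lpa_eq] containing
   the axioms of associative, not necessarily unital, K-algebras and the
   defining relations. *)
Inductive lpa_term (K : fieldType) (E : digraph) : Type :=
  | LVert of vertex E
  | LEdge of edge E
  | LGhost of edge E
  | LZero
  | LOpp of lpa_term K E
  | LAdd of lpa_term K E & lpa_term K E
  | LScale of K & lpa_term K E
  | LMul of lpa_term K E & lpa_term K E.

Arguments LVert {K E}.
Arguments LEdge {K E}.
Arguments LGhost {K E}.
Arguments LZero {K E}.

Section Leavitt.
Variables (K : fieldType) (E : digraph).
Local Notation term := (lpa_term K E).
Implicit Types (x y z t : term) (k l : K) (v w : vertex E) (e f : edge E).

Inductive lpa_eq : term -> term -> Prop :=
  | lpa_refl x : lpa_eq x x
  | lpa_sym x y : lpa_eq x y -> lpa_eq y x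
  | lpa_trans y x z : lpa_eq x y -> lpa_eq y z -> lpa_eq x z
  | lpa_opp x y : lpa_eq x y -> lpa_eq (LOpp x) (LOpp y)
  | lpa_add x y z t :
      lpa_eq x y -> lpa_eq z t -> lpa_eq (LAdd x z) (LAdd y t)
  | lpa_scale k x y : lpa_eq x y -> lpa_eq (LScale k x) (LScale k y)
  | lpa_mul x y z t :
      lpa_eq x y -> lpa_eq z t -> lpa_eq (LMul x z) (LMul y t)
  | lpa_addA x y z : lpa_eq (LAdd x (LAdd y z)) (LAdd (LAdd x y) z)
  | lpa_addC x y : lpa_eq (LAdd x y) (LAdd y x)
  | lpa_add0 x : lpa_eq (LAdd LZero x) x
  | lpa_addN x : lpa_eq (LAdd (LOpp x) x) LZero
  | lpa_scaleA k l x : lpa_eq (LScale k (LScale l x)) (LScale (k * l) x)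
  | lpa_scale1 x : lpa_eq (LScale 1 x) x
  | lpa_scaleDr k x y :
      lpa_eq (LScale k (LAdd x y)) (LAdd (LScale k x) (LScale k y))
  | lpa_scaleDl k l x :
      lpa_eq (LScale (k + l) x) (LAdd (LScale k x) (LScale l x))
  | lpa_mulA x y z : lpa_eq (LMul x (LMul y z)) (LMul (LMul x y) z)
  | lpa_mulDl x y z : lpa_eq (LMul (LAdd x y) z) (LAdd (LMul x z) (LMul y z))
  | lpa_mulDr x y z : lpa_eq (LMul x (LAdd y z)) (LAdd (LMul x y) (LMul x z))
  | lpa_scaleAl k x y : lpa_eq (LScale k (LMul x y)) (LMul (LScale k x) y)
  | lpa_scaleAr k x y : lpa_eq (LScale k (LMul x y)) (LMul x (LScale k y))
  | lpa_vert_idem v : lpa_eq (LMul (LVert v) (LVert v)) (LVert v)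
  | lpa_vert_orth v w : v <> w -> lpa_eq (LMul (LVert v) (LVert w)) LZero
  | lpa_source_edge e : lpa_eq (LMul (LVert (esource e)) (LEdge e)) (LEdge e)
  | lpa_edge_range e : lpa_eq (LMul (LEdge e) (LVert (erange e))) (LEdge e)
  | lpa_range_ghost e : lpa_eq (LMul (LVert (erange e)) (LGhost e)) (LGhost e)
  | lpa_ghost_source e : lpa_eq (LMul (LGhost e) (LVert (esource e))) (LGhost e)
  | lpa_ghost_edge e : lpa_eq (LMul (LGhost e) (LEdge e)) (LVert (erange e))
  | lpa_ghost_edge_orth e f : e <> f -> lpa_eq (LMul (LGhost e) (LEdge f)) LZero
  | lpa_regular v : regular v ->
      lpa_eq (LVert v)
        (\big[@LAdd K E/LZero]_(e <- fset_set (out_edges v))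
            LMul (LEdge e) (LGhost e)).

HB.instance Definition _ := gen_eqMixin term.
HB.instance Definition _ := gen_choiceMixin term.

Definition lpa_eqb : rel term := fun x y => `[< lpa_eq x y >].

Fact lpa_eqb_equiv : equiv_class_of lpa_eqb.
Proof.
split=> [x|x y|y x z]; first exact/asboolP/lpa_refl.
- by apply/asboolP/asboolP; apply: lpa_sym.
- by move=> /asboolP h1 /asboolP h2; apply/asboolP; apply: lpa_trans h1 h2.
Qed.

Canonical lpa_eqb_rel := EquivRelPack lpa_eqb_equiv.
Canonical lpa_eqb_enc := defaultEncModRel lpa_eqb.

Definition leavitt := {eq_quot lpa_eqb}.
HB.instance Definition _ := Choice.on leavitt.
HB.instance Definition _ := Quotient.on leavitt.

Definition lpa_class (x : term) : leavitt := \pi_leavitt x.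

Lemma lpa_classP x y : lpa_class x = lpa_class y <-> lpa_eq x y.
Proof.
split=> [/eqmodP/asboolP //|h]; exact/eqmodP/asboolP.
Qed.

Lemma lpa_reprK (a : leavitt) : lpa_class (repr a) = a.
Proof. exact: reprK. Qed.

Lemma lpa_repr_class x : lpa_eq (repr (lpa_class x)) x.
Proof. by apply/lpa_classP; rewrite lpa_reprK. Qed.

Definition leavitt_zero : leavitt := lpa_class LZero.
Definition leavitt_opp (a : leavitt) := lpa_class (LOpp (repr a)).
Definition leavitt_add (a b : leavitt) := lpa_class (LAdd (repr a) (repr b)).
Definition leavitt_scale k (a : leavitt) := lpa_class (LScale k (repr a)).
Definition leavitt_mul (a b : leavitt) := lpa_class (LMul (repr a) (repr b)).

Lemma leavitt_oppE x : leavitt_opp (lpa_class x) = lpa_class (LOpp x).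
Proof. exact/lpa_classP/lpa_opp/lpa_repr_class. Qed.

Lemma leavitt_addE x y :
  leavitt_add (lpa_class x) (lpa_class y) = lpa_class (LAdd x y).
Proof. apply/lpa_classP/lpa_add; exact: lpa_repr_class. Qed.

Lemma leavitt_scaleE k x :
  leavitt_scale k (lpa_class x) = lpa_class (LScale k x).
Proof. exact/lpa_classP/lpa_scale/lpa_repr_class. Qed.

Lemma leavitt_mulE x y :
  leavitt_mul (lpa_class x) (lpa_class y) = lpa_class (LMul x y).
Proof. apply/lpa_classP/lpa_mul; exact: lpa_repr_class. Qed.

Local Definition leavittE :=
  (leavitt_oppE, leavitt_addE, leavitt_scaleE, leavitt_mulE).

Fact leavitt_addA : associative leavitt_add.
Proof.
move=> a b c; rewrite -[a]lpa_reprK -[b]lpa_reprK -[c]lpa_reprK !leavittE.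
exact/lpa_classP/lpa_addA.
Qed.

Fact leavitt_addC : commutative leavitt_add.
Proof.
move=> a b; rewrite -[a]lpa_reprK -[b]lpa_reprK !leavittE.
exact/lpa_classP/lpa_addC.
Qed.

Fact leavitt_add0 : left_id leavitt_zero leavitt_add.
Proof.
by move=> a; rewrite -[a]lpa_reprK !leavittE; exact/lpa_classP/lpa_add0.
Qed.

Fact leavitt_addN : left_inverse leavitt_zero leavitt_opp leavitt_add.
Proof.
by move=> a; rewrite -[a]lpa_reprK !leavittE; exact/lpa_classP/lpa_addN.
Qed.

HB.instance Definition _ := GRing.isZmodule.Build leavitt
  leavitt_addA leavitt_addC leavitt_add0 leavitt_addN.

Lemma lpa_classD x y : lpa_class (LAdd x y) = lpa_class x + lpa_class y.
Proof. by rewrite [RHS]leavitt_addE. Qed.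

Fact leavitt_scaleA k l (a : leavitt) :
  leavitt_scale k (leavitt_scale l a) = leavitt_scale (k * l) a.
Proof. by rewrite -[a]lpa_reprK !leavittE; exact/lpa_classP/lpa_scaleA. Qed.

Fact leavitt_scale1 : left_id 1 leavitt_scale.
Proof.
by move=> a; rewrite -[a]lpa_reprK !leavittE; exact/lpa_classP/lpa_scale1.
Qed.

Fact leavitt_scaleDr : right_distributive leavitt_scale +%R.
Proof.
move=> k a b; rewrite -[a]lpa_reprK -[b]lpa_reprK -lpa_classD !leavittE.
by rewrite -lpa_classD; exact/lpa_classP/lpa_scaleDr.
Qed.

Fact leavitt_scaleDl (a : leavitt) : {morph leavitt_scale^~ a : k l / k + l}.
Proof.
move=> k l; rewrite /= -[a]lpa_reprK !leavittE -lpa_classD.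
exact/lpa_classP/lpa_scaleDl.
Qed.

HB.instance Definition _ := GRing.Zmodule_isLmodule.Build K leavitt
  leavitt_scaleA leavitt_scale1 leavitt_scaleDr leavitt_scaleDl.

Fact leavitt_mulA : associative leavitt_mul.
Proof.
move=> a b c; rewrite -[a]lpa_reprK -[b]lpa_reprK -[c]lpa_reprK !leavittE.
exact/lpa_classP/lpa_mulA.
Qed.

Fact leavitt_mulDl : left_distributive leavitt_mul +%R.
Proof.
move=> a b c; rewrite -[a]lpa_reprK -[b]lpa_reprK -[c]lpa_reprK.
by rewrite -lpa_classD !leavittE -lpa_classD; exact/lpa_classP/lpa_mulDl.
Qed.

Fact leavitt_mulDr : right_distributive leavitt_mul +%R.
Proof.
move=> a b c; rewrite -[a]lpa_reprK -[b]lpa_reprK -[c]lpa_reprK.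
by rewrite -lpa_classD !leavittE -lpa_classD; exact/lpa_classP/lpa_mulDr.
Qed.

HB.instance Definition _ := Zmodule_isRng.Build leavitt
  leavitt_mulA leavitt_mulDl leavitt_mulDr.

Lemma lpa_class0 : lpa_class LZero = 0. Proof. by []. Qed.

Lemma lpa_classN x : lpa_class (LOpp x) = - lpa_class x.
Proof. by rewrite [RHS]leavitt_oppE. Qed.

Lemma lpa_classZ k x : lpa_class (LScale k x) = k *: lpa_class x.
Proof. by rewrite [RHS]leavitt_scaleE. Qed.

Lemma lpa_classM x y : lpa_class (LMul x y) = rngmul (lpa_class x) (lpa_class y).
Proof. by rewrite [RHS]leavitt_mulE. Qed.

Lemma leavitt_scaleAl k (a b : leavitt) : k *: rngmul a b = rngmul (k *: a) b.
Proof.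
rewrite -[a]lpa_reprK -[b]lpa_reprK -lpa_classM -!lpa_classZ -lpa_classM.
exact/lpa_classP/lpa_scaleAl.
Qed.

Lemma leavitt_scaleAr k (a b : leavitt) : k *: rngmul a b = rngmul a (k *: b).
Proof.
rewrite -[a]lpa_reprK -[b]lpa_reprK -lpa_classM -!lpa_classZ -lpa_classM.
exact/lpa_classP/lpa_scaleAr.
Qed.

End Leavitt.

Section TailClass.
Variables (E : digraph) (p : nat -> edge E).
Local Notation cls := (tail_path p).

Definition scons (e : edge E) (q : nat -> edge E) : nat -> edge E :=
  fun i => if i is j.+1 then q j else e.

Lemma tail_class_scons e (q : cls) :
  esource (val q 0%N) = erange e -> scons e (val q) \in tail_class p.
Proof.
case: q => q /= /set_mem [hq [m [n [m0 n0 hmn]]]] h; apply/mem_set; split.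
  by case=> [|i] /=; rewrite ?h.
by exists m, n.+1; split.
Qed.

Lemma tail_class_behead (q : cls) : tail 1 (val q) \in tail_class p.
Proof.
case: q => q /= /set_mem [hq [m [n [m0 n0 hmn]]]]; apply/mem_set; split.
  by move=> i; rewrite /tail !add1n hq.
exists m.+1, n; split=> // i; have := hmn i.+1.
by rewrite /tail !addnS addSn add1n.
Qed.

Definition cls_scons e (q : cls) (h : esource (val q 0%N) = erange e) : cls :=
  exist _ (scons e (val q)) (tail_class_scons h).

Definition cls_behead (q : cls) : cls :=
  exist _ (tail 1 (val q)) (tail_class_behead q).

End TailClass.

(* [chen K p] is the Chen module V_[p]: the K-vector space with basis
   [tail_path p], on which the action of [leavitt K E] is K-linear in both
   arguments and given on the basis by [chen_vert], [chen_edge], [chen_ghost]. *)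
Section Chen.
Variables (K : fieldType) (E : digraph) (p : nat -> edge E).
Local Notation cls := (tail_path p).

Definition chen := {freeg cls / K}.
HB.instance Definition _ := GRing.Lmodule.on chen.

Definition chen_basis (q : cls) : chen := << q >>.

Definition chen_extend (f : cls -> chen) (m : chen) : chen := fglift f m.

Lemma chen_extendU (f : cls -> chen) q : chen_extend f (chen_basis q) = f q.
Proof. by rewrite /chen_extend /chen_basis liftU scale1r. Qed.

Lemma freeg_scaleU (k : K) (q : cls) : << k *g q >> = k *: chen_basis q.
Proof. by apply/eqP/freeg_eqP => r; rewrite coeffZ !coeffU mul1r. Qed.

Lemma chen_sumE (m : chen) : m = \sum_(q <- dom m) (coeff q m : K) *: chen_basis q.
Proof.
by rewrite -[LHS]freeg_sumE; apply: eq_bigr => q _; rewrite freeg_scaleU.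
Qed.

Fact chen_extend_linear f : linear (chen_extend f).
Proof.
have fB : zmod_morphism (chen_extend f) by exact: lift_is_additive.
have f0 : chen_extend f 0 = 0 by have := fB 0 0; rewrite !subrr.
have fD : {morph chen_extend f : x y / x + y}.
  by move=> x y; rewrite -{1}[y]opprK fB -(sub0r y) fB f0 sub0r opprK.
move=> k x y; rewrite fD; congr (_ + _).
rewrite (chen_sumE x) scaler_sumr !(big_morph _ fD f0) scaler_sumr.
apply: eq_bigr => q _; rewrite scalerA -!freeg_scaleU.
by rewrite /chen_extend !liftU scalerA.
Qed.

HB.instance Definition _ (f : cls -> chen) :=
  GRing.isLinear.Build K chen chen *:%R (chen_extend f) (chen_extend_linear f).

Definition chen_vert (v : vertex E) (q : cls) : chen :=
  if esource (val q 0%N) == v then chen_basis q else 0.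

Definition chen_edge (e : edge E) (q : cls) : chen :=
  if pselect (esource (val q 0%N) = erange e) is left h
  then chen_basis (cls_scons h) else 0.

Definition chen_ghost (e : edge E) (q : cls) : chen :=
  if val q 0%N == e then chen_basis (cls_behead q) else 0.

Fixpoint chen_term (x : lpa_term K E) (m : chen) : chen :=
  match x with
  | LVert v => chen_extend (chen_vert v) m
  | LEdge e => chen_extend (chen_edge e) m
  | LGhost e => chen_extend (chen_ghost e) m
  | LZero => 0
  | LOpp x => - chen_term x m
  | LAdd x y => chen_term x m + chen_term y m
  | LScale k x => k *: chen_term x m
  | LMul x y => chen_term x (chen_term y m)
  end.

Fact chen_term_linear (x : lpa_term K E) : linear (chen_term x).
Proof.
elim: x => [v|e|e||x IH|x IHx y IHy|l x IH|x IHx y IHy] k m n /=.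
- by rewrite linearP.
- by rewrite linearP.
- by rewrite linearP.
- by rewrite scaler0 addr0.
- by rewrite IH opprD scalerN.
- by rewrite IHx IHy scalerDr addrACA.
- by rewrite IH scalerDr !scalerA mulrC.
- by rewrite IHy IHx.
Qed.

HB.instance Definition _ (x : lpa_term K E) :=
  GRing.isLinear.Build K chen chen *:%R (chen_term x) (chen_term_linear x).

Lemma chen_ext (f g : {linear chen -> chen}) :
  (forall q, f (chen_basis q) = g (chen_basis q)) -> f =1 g.
Proof.
move=> h m; rewrite (chen_sumE m) !raddf_sum.
by apply: eq_bigr => q _; rewrite /= !linearZ h.
Qed.

Lemma chen_edge1 e (q : cls) (h : esource (val q 0%N) = erange e) :
  chen_edge e q = chen_basis (cls_scons h).
Proof.
rewrite /chen_edge; case: pselect => // h'; congr chen_basis; exact: val_inj.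
Qed.

Lemma chen_edge0 e (q : cls) :
  esource (val q 0%N) <> erange e -> chen_edge e q = 0.
Proof. by rewrite /chen_edge; case: pselect. Qed.

Lemma cls_range (q : cls) : esource (val (cls_behead q) 0%N) = erange (val q 0%N).
Proof. by rewrite /= /tail; have [hq _] := set_mem (valP q); rewrite hq. Qed.

Lemma cls_sconsK (q : cls)
    (h : esource (val (cls_behead q) 0%N) = erange (val q 0%N)) :
  cls_scons h = q.
Proof. by apply: val_inj; apply/funext => -[|i]. Qed.

Lemma cls_beheadK e (q : cls) (h : esource (val q 0%N) = erange e) :
  cls_behead (cls_scons h) = q.
Proof. by apply: val_inj; apply/funext. Qed.

Lemma chen_edge_ghost e (q : cls) :
  chen_extend (chen_edge e) (chen_ghost e q) =
    if val q 0%N == e then chen_basis q else 0.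
Proof.
rewrite /chen_ghost; case: eqP => [<-|_]; last by rewrite raddf0.
by rewrite chen_extendU (chen_edge1 (cls_range q)) cls_sconsK.
Qed.

Lemma chen_term_eq (x y : lpa_term K E) :
  lpa_eq x y -> chen_term x =1 chen_term y.
Proof.
elim=> {x y} //=.
- by move=> x y _ h m; rewrite h.
- by move=> x y z _ h1 _ h2 m; rewrite h1 h2.
- by move=> x y _ h m; rewrite h.
- by move=> x y z t _ h1 _ h2 m; rewrite h1 h2.
- by move=> k x y _ h m; rewrite h.
- by move=> x y z t _ h1 _ h2 m; rewrite h2 h1.
- by move=> x y z m; rewrite addrA.
- by move=> x y m; rewrite addrC.
- by move=> x m; rewrite add0r.
- by move=> x m; rewrite addNr.
- by move=> k l x m; rewrite scalerA.
- by move=> x m; rewrite scale1r.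
- by move=> k x y m; rewrite scalerDr.
- by move=> k l x m; rewrite scalerDl.
- by move=> x y z m; rewrite linearD.
- by move=> k x y m; rewrite linearZ.
- move=> v; apply: (chen_ext (f := chen_extend (chen_vert v) \o chen_extend (chen_vert v))).
  move=> q /=; rewrite chen_extendU /chen_vert; case: ifP => h; last by rewrite raddf0.
  by rewrite chen_extendU /chen_vert h.
- move=> v w vw; apply: (chen_ext (f := chen_extend (chen_vert v) \o chen_extend (chen_vert w))
    (g := \0)) => q /=.
  rewrite chen_extendU /chen_vert; case: eqP => h; last by rewrite raddf0.
  by rewrite chen_extendU /chen_vert h; case: eqP => // /esym.
- move=> e; apply: (chen_ext (f := chen_extend (chen_vert (esource e)) \o chen_extend (chen_edge e))).
  move=> q /=; rewrite chen_extendU; have [h|h] := pselect (esource (val q 0%N) = erange e).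
    by rewrite (chen_edge1 h) chen_extendU /chen_vert /= eqxx.
  by rewrite (chen_edge0 h) raddf0.
- move=> e; apply: (chen_ext (f := chen_extend (chen_edge e) \o chen_extend (chen_vert (erange e)))).
  move=> q /=; rewrite !chen_extendU /chen_vert; case: eqP => [_|h]; first by rewrite chen_extendU.
  by rewrite (chen_edge0 h) raddf0.
- move=> e; apply: (chen_ext (f := chen_extend (chen_vert (erange e)) \o chen_extend (chen_ghost e))).
  move=> q /=; rewrite !chen_extendU /chen_ghost; case: eqP => [<-|_]; last by rewrite raddf0.
  by rewrite chen_extendU /chen_vert cls_range eqxx.
- move=> e; apply: (chen_ext (f := chen_extend (chen_ghost e) \o chen_extend (chen_vert (esource e)))).
  move=> q /=; rewrite !chen_extendU /chen_vert; case: eqP => [_|h]; first by rewrite chen_extendU.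
  by rewrite raddf0 /chen_ghost; case: eqP => // e'; case: h; rewrite e'.
- move=> e; apply: (chen_ext (f := chen_extend (chen_ghost e) \o chen_extend (chen_edge e))).
  move=> q /=; rewrite !chen_extendU /chen_vert; case: eqP => h.
    by rewrite (chen_edge1 h) chen_extendU /chen_ghost /= eqxx cls_beheadK.
  by rewrite (chen_edge0 h) raddf0.
- move=> e f ef; apply: (chen_ext (f := chen_extend (chen_ghost e) \o chen_extend (chen_edge f)) (g := \0)).
  move=> q /=; rewrite chen_extendU; have [h|h] := pselect (esource (val q 0%N) = erange f).
    by rewrite (chen_edge1 h) chen_extendU /chen_ghost /=; case: eqP => // /esym.
  by rewrite (chen_edge0 h) raddf0.
- move=> v [fv _].
  have E1 s m : chen_term (\big[@LAdd K E/LZero]_(e <- s) LMul (LEdge e) (LGhost e)) m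
     = \sum_(e <- s) chen_extend (chen_edge e) (chen_extend (chen_ghost e) m).
    elim: s => [|e s IH]; first by rewrite !big_nil.
    by rewrite !big_cons /= IH.
  apply: (chen_ext (f := chen_extend (chen_vert v)) (g := chen_term _)) => q.
  rewrite /= E1 chen_extendU.
  under eq_bigr do rewrite chen_extendU chen_edge_ghost.
  rewrite /chen_vert; case: eqP => hq.
    have qv : val q 0%N \in fset_set (out_edges v).
      by rewrite in_fset_set //; apply/mem_set.
    rewrite (bigD1_seq _ qv) ?fset_uniq //= eqxx big1 ?addr0 // => e.
    by rewrite eq_sym => /negPf ->.
  rewrite big_seq big1 // => e; rewrite in_fset_set // => /set_mem he.
  by case: eqP => // e'; case: hq; rewrite e'.
Qed.

Definition chen_act (a : leavitt K E) (m : chen) : chen := chen_term (repr a) m.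

Lemma chen_act_class (x : lpa_term K E) m :
  chen_act (lpa_class x) m = chen_term x m.
Proof. exact/chen_term_eq/lpa_repr_class. Qed.

Fact chen_actA (a b : leavitt K E) m :
  chen_act (rngmul a b) m = chen_act a (chen_act b m).
Proof.
by rewrite -[a]lpa_reprK -[b]lpa_reprK -lpa_classM !chen_act_class.
Qed.

Fact chen_actDl (a b : leavitt K E) m :
  chen_act (a + b) m = chen_act a m + chen_act b m.
Proof.
by rewrite -[a]lpa_reprK -[b]lpa_reprK -lpa_classD !chen_act_class.
Qed.

Fact chen_actDr (a : leavitt K E) m m' :
  chen_act a (m + m') = chen_act a m + chen_act a m'.
Proof. exact: linearD. Qed.

Fact chen_act_full m :
  exists (n : nat) (a : 'I_n -> leavitt K E) (y : 'I_n -> chen),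
    m = \sum_(i < n) chen_act (a i) (y i).
Proof.
pose d := in_tuple (dom m).
exists (size (dom m)), (fun i => lpa_class (LVert (esource (val (tnth d i) 0%N)))),
  (fun i => (coeff (tnth d i) m : K) *: chen_basis (tnth d i)).
rewrite [LHS]chen_sumE (big_tnth _ _ (dom m)); apply: eq_bigr => i _.
by rewrite chen_act_class /= linearZ /= chen_extendU /chen_vert eqxx.
Qed.

HB.instance Definition _ := Zmodule_isUmodule.Build (leavitt K E) chen
  chen_actA chen_actDl chen_actDr chen_act_full.

Lemma chen_act_vert v q :
  act (lpa_class (LVert v) : leavitt K E) (chen_basis q) = chen_vert v q.
Proof. by rewrite [LHS]chen_act_class /= chen_extendU. Qed.

Lemma chen_act_edge e q :
  act (lpa_class (LEdge e) : leavitt K E) (chen_basis q) = chen_edge e q.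
Proof. by rewrite [LHS]chen_act_class /= chen_extendU. Qed.

Lemma chen_act_ghost e q :
  act (lpa_class (LGhost e) : leavitt K E) (chen_basis q) = chen_ghost e q.
Proof. by rewrite [LHS]chen_act_class /= chen_extendU. Qed.

Lemma chen_actZ k (a : leavitt K E) m : act (k *: a) m = k *: (act a m : chen).
Proof.
by rewrite -[a]lpa_reprK -lpa_classZ [LHS]chen_act_class /= -chen_act_class.
Qed.

End Chen.

(* Main.v *)
Require Import Defs.
From HB Require Import structures.
From mathcomp Require Import all_boot all_algebra.
From mathcomp Require Import finmap boolp classical_sets cardinality.
From mathcomp Require Import freeg.

Set Implicit Arguments.
Unset Strict Implicit.
Unset Printing Implicit Defensive.

Import GRing.Theory.

Local Open Scope ring_scope.
Local Open Scope classical_set_scope.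

Local Notation "a ** b" := (rngmul a b) (at level 40, left associativity).

(** Let [V = V_[p]] and let [p_n] be the segment of the first [n] edges of [p].
   Everything rests on one description of annihilators: for [q] in [[p]], an
   element [a] of [L] kills the basis vector [q] if and only if it kills, inside
   [L], all long enough initial segments of [q] ([annihilator_segment]).  Since
   [p] is irrational, a path [r] tail-equivalent to [p] has at most one [l] with
   [tau^(>l)(r) = tau^(>n)(p)], so that cutting [r] after [l] edges defines a
   linear map [truncation n] from [V] to [L]; it sends [p] to [p_n].  It commutes
   with a given generator on a given vector as soon as [n] is large
   ([truncation_act]); in other words, [V] is the direct limit of the modules
   [L r(e_n)] under right multiplication by the edges of [p].

   Let [V] be finitely presented, say [V = P/N] with [P] projective and [N]
   finitely generated.  Lift the quotient map through the surjection
   [a |-> a p] of [L] onto [V].  The images in [L] of the finitely many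
   generators of [N] kill [p], hence they all kill one [p_n], and it follows that
   any [a] with [a p = 0] satisfies [a p_n = 0]
   ([finitely_presented_annihilator]).  If some vertex of [p] after the [n]-th
   edge, say the source of the edge [e_(k+1)], emitted a second edge [f], this
   would apply to [a = f^* p_k^*] and give
   [r(f) = f^* f = f^* p_k^* p_k f = 0], whereas vertices are nonzero in [L]
   ([vertex_elt_neq0]).  So [p] has no bifurcation after its [n]-th edge; every
   path from there follows [p], and a cycle would make [p] rational
   ([no_bifurcation_line_point]).

   Conversely, let [w] be a line point on [p] and [q] the tail of [p] that starts
   at [w].  All initial segments of [q] then satisfy [q_l q_l^* = w], so that
   [a q = 0] forces [a w = a q_l q_l^* = 0]: the module [V] is isomorphic to the
   projective module [L w], and maps out of [V] can be lifted by choosing the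
   image of [q] ([line_point_projective]).  Finally [V] is cyclic, so if it is
   projective it is finitely presented by itself. *)

(** * Rings without identity and their modules *)

Section NonUnital.
Variable R : rngType.

Lemma rngmul0r (a : R) : 0 ** a = 0.
Proof. by apply: (@addrI _ (0 ** a)); rewrite -rngmulDl !addr0. Qed.

Lemma rngmulr0 (a : R) : a ** 0 = 0.
Proof. by apply: (@addrI _ (a ** 0)); rewrite -rngmulDr !addr0. Qed.

Lemma rngmulNr (a b : R) : (- a) ** b = - (a ** b).
Proof. by apply: (@addrI _ (a ** b)); rewrite -rngmulDl !subrr rngmul0r. Qed.

Lemma rngmulBl (a b c : R) : (a - b) ** c = a ** c - b ** c.
Proof. by rewrite rngmulDl rngmulNr. Qed.

Lemma rngmul_sumlA n (b : 'I_n -> R) (x : 'I_n -> R) c :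
  (\sum_i b i ** x i) ** c = \sum_i b i ** (x i ** c).
Proof.
rewrite (big_morph (fun y => y ** c) (fun x y => rngmulDl x y c) (rngmul0r c)).
by apply: eq_bigr => i _; rewrite rngmulA.
Qed.

Variables M M' : umodType R.

Lemma act0l (x : M) : act (0 : R) x = 0.
Proof. by apply: (@addrI _ (act 0 x)); rewrite -actDl !addr0. Qed.

Lemma actNl (a : R) (x : M) : act (- a) x = - act a x.
Proof. by apply: (@addrI _ (act a x)); rewrite -actDl !subrr act0l. Qed.

Lemma is_hom0 (f : M -> M') : is_hom f -> f 0 = 0.
Proof. by case=> fD _; apply: (@addrI _ (f 0)); rewrite -fD !addr0. Qed.

Lemma is_hom_sum (f : M -> M') n (a : 'I_n -> R) (x : 'I_n -> M) :
  is_hom f -> f (\sum_i act (a i) (x i)) = \sum_i act (a i) (f (x i)).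
Proof.
move=> fh; rewrite (big_morph f fh.1 (is_hom0 fh)).
by apply: eq_bigr => i _; rewrite fh.2.
Qed.

End NonUnital.

Definition zero_submodule (R : rngType) (M : umodType R) : {pred M} :=
  fun x => x == 0.

Section ZeroSubmodule.
Variables (R : rngType) (M : umodType R).

Fact zero_submodule_zmod_closed : zmod_closed (@zero_submodule R M).
Proof.
split=> [|x y]; rewrite !unfold_in ?eqxx // => /eqP -> /eqP ->.
by rewrite subrr.
Qed.

Fact zero_submodule_act_closed (a : R) (x : M) :
  x \in @zero_submodule R M -> act a x \in @zero_submodule R M.
Proof. by rewrite !unfold_in => /eqP ->; rewrite act0r. Qed.

HB.instance Definition _ := GRing.isZmodClosed.Build M (@zero_submodule R M)
  zero_submodule_zmod_closed.
HB.instance Definition _ := isActClosed.Build R M (@zero_submodule R M)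
  zero_submodule_act_closed.

Definition zero_usubmod : usubmod M :=
  Usubmod.clone _ _ (@zero_submodule R M) _.

Lemma finitely_presented_projective :
  finitely_generated M -> projective M -> finitely_presented M.
Proof.
move=> fg pr; exists M, zero_usubmod; split=> //.
  exists 0%N, (fun=> 0); split=> [[]//|y]; rewrite unfold_in => /eqP ->.
  by exists (fun=> 0); rewrite big_ord0.
exists (@quot_proj R M zero_usubmod); split.
  by split=> [x y|a x]; [rewrite quot_projD | rewrite -quot_actE].
exists (@quot_repr R M zero_usubmod); last exact: quot_reprK.
move=> x; apply/eqP; rewrite -subr_eq0.
by apply/(@quot_projP R M zero_usubmod); rewrite quot_reprK.
Qed.

End ZeroSubmodule.

(** * Multiplication in the Leavitt path algebra *)

Section LeavittRelations.
Variables (K : fieldType) (E : digraph).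
Local Notation L := (leavitt K E).
Implicit Types (v w : vertex E) (e f : edge E).

Definition vertex_elt v : L := lpa_class (LVert v).
Definition edge_elt e : L := lpa_class (LEdge e).
Definition ghost_elt e : L := lpa_class (LGhost e).

Lemma vertexM v w :
  vertex_elt v ** vertex_elt w = if v == w then vertex_elt v else 0.
Proof.
rewrite -lpa_classM; case: eqP => [<-|vw]; apply/lpa_classP.
  exact: lpa_vert_idem.
exact: lpa_vert_orth.
Qed.

Lemma source_edgeM e : vertex_elt (esource e) ** edge_elt e = edge_elt e.
Proof. by rewrite -lpa_classM; apply/lpa_classP/lpa_source_edge. Qed.

Lemma edge_rangeM e : edge_elt e ** vertex_elt (erange e) = edge_elt e.
Proof. by rewrite -lpa_classM; apply/lpa_classP/lpa_edge_range. Qed.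

Lemma range_ghostM e : vertex_elt (erange e) ** ghost_elt e = ghost_elt e.
Proof. by rewrite -lpa_classM; apply/lpa_classP/lpa_range_ghost. Qed.

Lemma ghost_sourceM e : ghost_elt e ** vertex_elt (esource e) = ghost_elt e.
Proof. by rewrite -lpa_classM; apply/lpa_classP/lpa_ghost_source. Qed.

Lemma ghost_edgeM e f :
  ghost_elt e ** edge_elt f = if e == f then vertex_elt (erange e) else 0.
Proof.
rewrite -lpa_classM; case: eqP => [<-|ef]; apply/lpa_classP.
  exact: lpa_ghost_edge.
exact: lpa_ghost_edge_orth.
Qed.

Lemma vertex_edgeM v e :
  vertex_elt v ** edge_elt e = if v == esource e then edge_elt e else 0.
Proof.
rewrite -{1}source_edgeM rngmulA vertexM; case: eqP => [->|_].
  exact: source_edgeM.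
exact: rngmul0r.
Qed.

Lemma lpa_class_big (I : Type) (s : seq I) (F : I -> lpa_term K E) :
  lpa_class (\big[@LAdd K E/LZero]_(i <- s) F i) =
    \sum_(i <- s) lpa_class (F i).
Proof.
by elim: s => [|i s IH]; rewrite ?big_nil // !big_cons lpa_classD IH.
Qed.

Lemma vertex_elt_regular v : regular v ->
  vertex_elt v = \sum_(e <- fset_set (out_edges v)) edge_elt e ** ghost_elt e.
Proof.
move=> /(lpa_regular K)/lpa_classP; rewrite lpa_class_big.
rewrite -[lpa_class (LVert v)]/(vertex_elt v) => ->.
by apply: eq_bigr => e _; rewrite lpa_classM.
Qed.

(** The last defining relation at a vertex that emits a single edge. *)
Lemma edge_ghost_single e : out_edges (esource e) = [set e] ->
  edge_elt e ** ghost_elt e = vertex_elt (esource e).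
Proof.
move=> oe; have reg : regular (esource e).
  by rewrite /regular oe; split; [exact: finite_set1 | exists e].
by rewrite (vertex_elt_regular reg) oe fset_set1 big_seq_fset1.
Qed.

(** A property of elements closed under all the operations is proved on the
   generators, without choosing normal forms. *)
Lemma leavitt_linear_ind (P : L -> Prop) :
  (forall v, P (vertex_elt v)) -> (forall e, P (edge_elt e)) ->
  (forall e, P (ghost_elt e)) -> P 0 -> (forall a, P a -> P (- a)) ->
  (forall a b, P a -> P b -> P (a + b)) -> (forall k a, P a -> P (k *: a)) ->
  (forall a b, P a -> P b -> P (a ** b)) -> forall a, P a.
Proof.
move=> Pv Pe Pg P0 PN PD PZ PM a; rewrite -[a]lpa_reprK.
elim: (repr a) => //= [x IH|x IHx y IHy|k x IH|x IHx y IHy].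
- by rewrite lpa_classN; apply: PN.
- by rewrite lpa_classD; apply: PD.
- by rewrite lpa_classZ; apply: PZ.
- by rewrite lpa_classM; apply: PM.
Qed.

(** [L = L L], because [v = v v], [e = s(e) e] and [e^* = r(e) e^*]; this makes
   [L] a module over itself. *)
Fact leavitt_full (a : L) : exists (n : nat) (b c : 'I_n -> L),
  a = \sum_(i < n) b i ** c i.
Proof.
have single b c : exists (n : nat) (b' c' : 'I_n -> L),
    b ** c = \sum_(i < n) b' i ** c' i.
  by exists 1%N, (fun=> b), (fun=> c); rewrite big_ord1.
elim/leavitt_linear_ind: a => [v|e|e||a|a b|k a|a b _ _ //].
- by have := single (vertex_elt v) (vertex_elt v); rewrite vertexM eqxx.
- by rewrite -source_edgeM; apply: single.
- by rewrite -range_ghostM; apply: single.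
- by exists 0%N, (fun=> 0), (fun=> 0); rewrite big_ord0.
- move=> [n [b [c ->]]]; exists n, (fun i => - b i), c.
  by rewrite -sumrN; apply: eq_bigr => i _; rewrite rngmulNr.
- move=> [n [c [d ->]]] [m [c' [d' ->]]].
  exists (n + m)%N.
  exists (fun i => match split i with inl i => c i | inr i => c' i end).
  exists (fun i => match split i with inl i => d i | inr i => d' i end).
  rewrite big_split_ord /=; congr (_ + _); apply: eq_bigr => i _.
    by rewrite (unsplitK (inl i)).
  by rewrite (unsplitK (inr i)).
- move=> [n [b [c ->]]]; exists n, (fun i => k *: b i), c.
  by rewrite scaler_sumr; apply: eq_bigr => i _; rewrite leavitt_scaleAl.
Qed.

HB.instance Definition _ := Zmodule_isUmodule.Build L L
  (fun a b c => esym (rngmulA a b c)) (fun a b c => rngmulDl a b c)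
  (fun a b c => rngmulDr a b c) leavitt_full.

End LeavittRelations.

(** * Vertices are nonzero *)

Section SinkLoops.
Variable E : digraph.

Definition sink (v : vertex E) : Prop := forall e, esource e <> v.

(** Adding a loop at every sink gives a graph in which every vertex starts an
   infinite path, hence acts on some Chen module without being zero.  The
   relations of the old algebra persist, since sinks are not regular and the
   other vertices emit the same edges as before. *)
Definition sink_loops : digraph :=
  @Digraph (vertex E) (edge E + {v : vertex E | sink v})
    (fun e => match e with inl e => esource e | inr v => sval v end)
    (fun e => match e with inl e => erange e | inr v => sval v end).

Lemma sink_loops_out (v : vertex E) : exists e : edge sink_loops, esource e = v.
Proof.
have [[e ev]|nv] := pselect (exists e : edge E, esource e = v).
  by exists (inl e).
by exists (inr (exist _ v (fun e ev => nv (ex_intro _ e ev)))).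
Qed.

Lemma sink_loops_out_edges (v : vertex E) : regular v ->
  out_edges (v : vertex sink_loops) = inl @` out_edges v.
Proof.
move=> [_ [e0 e0v]]; apply/seteqP; split=> [|e /= [e' e'v <-]] //.
case=> [e|[w hw]] /= ev.
  by exists e.
by case: (hw e0); exact: etrans e0v (esym ev).
Qed.

Fixpoint sink_loops_term (K : fieldType) (x : lpa_term K E) :
    lpa_term K sink_loops :=
  match x with
  | LVert v => @LVert K sink_loops v
  | LEdge e => @LEdge K sink_loops (inl e)
  | LGhost e => @LGhost K sink_loops (inl e)
  | LZero => LZero
  | LOpp x => LOpp (sink_loops_term x)
  | LAdd x y => LAdd (sink_loops_term x) (sink_loops_term y)
  | LScale k x => LScale k (sink_loops_term x)
  | LMul x y => LMul (sink_loops_term x) (sink_loops_term y)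
  end.

Lemma sink_loops_term_eq (K : fieldType) (x y : lpa_term K E) :
  lpa_eq x y -> lpa_eq (sink_loops_term x) (sink_loops_term y).
Proof.
elim=> {x y} /=; try by move=> *; constructor.
- by move=> x y z _ h1 _ h2; apply: lpa_trans h1 h2.
- by move=> e; apply: (@lpa_source_edge K sink_loops (inl e)).
- by move=> e; apply: (@lpa_edge_range K sink_loops (inl e)).
- by move=> e; apply: (@lpa_range_ghost K sink_loops (inl e)).
- by move=> e; apply: (@lpa_ghost_source K sink_loops (inl e)).
- by move=> e; apply: (@lpa_ghost_edge K sink_loops (inl e)).
- by move=> e f ef; apply: lpa_ghost_edge_orth => -[].
move=> v rv; have [fv [e0 e0v]] := rv.
have rv' : regular (v : vertex sink_loops).
  rewrite /regular sink_loops_out_edges //; split; first exact: finite_image.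
  by exists (inl e0), e0.
apply/lpa_classP; rewrite -[LHS]/(vertex_elt K (v : vertex sink_loops)).
rewrite (vertex_elt_regular K rv') sink_loops_out_edges // fset_set_image //.
rewrite big_imfset /=; last by move=> e f _ _ [].
rewrite (@big_morph _ _ _ LZero (@LAdd K _) LZero (@LAdd K _)) //.
by rewrite lpa_class_big; apply: eq_bigr => e _; rewrite lpa_classM.
Qed.

End SinkLoops.

Lemma exists_infinite_path (E : digraph) (v : vertex E) :
  (forall w : vertex E, exists e, esource e = w) ->
  exists q : nat -> edge E, infinite_path q /\ esource (q 0%N) = v.
Proof.
move=> out; have [nxt nxtP] := choice out.
exists (fun i => nxt (iter i (fun w => erange (nxt w)) v)).
by split=> [i|]; rewrite nxtP.
Qed.

Lemma tail_class_refl (E : digraph) (p : nat -> edge E) :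
  infinite_path p -> p \in tail_class p.
Proof. by move=> hp; apply/mem_set; split=> //; exists 1%N, 1%N. Qed.

Lemma chen_basis_neq0 (K : fieldType) (E : digraph) (p : nat -> edge E)
  (q : tail_path p) : chen_basis K q != 0.
Proof.
apply/eqP => /(congr1 (coeff q)) /eqP.
by rewrite coeffU coeff0 eqxx mulr1 oner_eq0.
Qed.

(** A presentation by generators and relations could collapse; that it does not
   is seen on a module where the vertex acts nontrivially. *)
Lemma vertex_elt_neq0 (K : fieldType) (E : digraph) (v : vertex E) :
  vertex_elt K v <> 0.
Proof.
move=> /lpa_classP/sink_loops_term_eq /= v0.
have [p [hp pv]] := @exists_infinite_path (sink_loops E) v (@sink_loops_out E).
pose q : tail_path p := exist _ p (tail_class_refl hp).
have := chen_term_eq v0 (chen_basis K q).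
rewrite /= chen_extendU /chen_vert pv eqxx => /eqP.
by rewrite (negPf (chen_basis_neq0 _ _)).
Qed.

(** * Tails of infinite paths *)

Section Tails.
Variable E : digraph.
Implicit Types p q r : nat -> edge E.

Lemma tailD m n p : tail m (tail n p) = tail (n + m) p.
Proof. by apply/funext => i; rewrite /tail addnA. Qed.

Lemma infinite_path_tail n p : infinite_path p -> infinite_path (tail n p).
Proof. by move=> hp i; rewrite /tail hp addnS. Qed.

Lemma tail_periodic n d p : tail (n + d) p = tail n p ->
  forall i, p (n + i)%N = p (n + i %% d)%N.
Proof.
move=> per; have [->|d0] := posnP d => [i|]; first by rewrite modn0.
elim/ltn_ind=> i IH; have [id|di] := ltnP i d; first by rewrite modn_small.
rewrite -{1}(subnKC di) addnA -[LHS]/(tail (n + d) p (i - d)%N) per.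
by rewrite [LHS]IH ?ltn_subrL ?d0 ?(leq_trans d0 di) // -{2}(subnKC di) modnDl.
Qed.

Lemma is_path_segment n p l : infinite_path p ->
  is_path (esource (p n)) (mkseq (tail n p) l) (esource (p (n + l)%N)).
Proof.
move=> hp; elim: l n => [|l IH] n /=; first by rewrite addn0.
rewrite /tail addn0; split=> //; rewrite hp.
have := IH n.+1; rewrite addSnnS.
rewrite (_ : mkseq (tail n.+1 p) l = [seq p (n + i)%N | i <- iota 1 l]) //.
by rewrite (iotaDl 1 0) -map_comp; apply: eq_map => i; rewrite /tail /= addSnnS.
Qed.

(** If two tails of [p] with different offsets agree, then [p] is eventually
   periodic, and its period is a closed path. *)
Lemma periodic_rational n d p : infinite_path p -> (0 < d)%N ->
  tail (n + d) p = tail n p -> rational p.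
Proof.
case: d => // d hp _ per.
exists (esource (p n)), (p n), (behead (mkseq (tail n p) d.+1)).
have cE : p n :: behead (mkseq (tail n p) d.+1) = mkseq (tail n p) d.+1.
  by rewrite /mkseq /= /tail addn0.
rewrite cE; split.
  split=> //; have := is_path_segment n d.+1 hp.
  suff -> : p (n + d.+1)%N = p n by [].
  by rewrite (tail_periodic per) modnn addn0.
exists (n + d.+1)%N, d.+1; split; rewrite ?addn_gt0 ?orbT // => i.
rewrite per /tail /repeat_path cE size_mkseq nth_mkseq ?ltn_pmod //.
by rewrite modnDl [LHS](tail_periodic per).
Qed.

(** The position at which a path joins [p] is unique, which makes truncation well
   defined: two such positions would make [p] rational. *)
Lemma irrational_tail_inj p q m n l : infinite_path p -> ~ rational p ->
  tail m q = tail n p -> tail l q = tail n p -> m = l.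
Proof.
move=> hp irr; wlog ml : m l / (m <= l)%N => [W hm hl|hm hl].
  have [ml|lm] := leqP m l; first exact: W.
  by apply/esym/W => //; exact: ltnW.
have [/eqP d0|d0] := posnP (l - m)%N.
  by apply/eqP; rewrite eqn_leq ml -subn_eq0.
case: irr; apply: (@periodic_rational n (l - m)) => //.
by rewrite -tailD -hm tailD subnKC // hl hm.
Qed.

End Tails.

(** * Initial segments of infinite paths as elements of the algebra *)

Section Segments.
Variables (K : fieldType) (E : digraph).
Local Notation vx := (vertex_elt K).
Local Notation ed := (edge_elt K).
Local Notation gh := (ghost_elt K).
Implicit Types (r : nat -> edge E) (l k : nat).

(** The trailing vertex makes the empty segment at [r] the vertex where [r]
   starts, as the algebra has no identity to stand for it. *)
Fixpoint path_elt r l : leavitt K E :=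
  if l is l'.+1 then ed (r 0%N) ** path_elt (tail 1 r) l'
  else vx (esource (r 0%N)).

Fixpoint ghost_path_elt r l : leavitt K E :=
  if l is l'.+1 then ghost_path_elt (tail 1 r) l' ** gh (r 0%N)
  else vx (esource (r 0%N)).

Lemma vertex_pathM v r l :
  vx v ** path_elt r l = if v == esource (r 0%N) then path_elt r l else 0.
Proof.
case: l => [|l] /=; first by rewrite vertexM; case: eqP => [->|].
by rewrite rngmulA vertex_edgeM; case: eqP => // _; rewrite rngmul0r.
Qed.

Lemma edge_pathM e r l :
  ed e ** path_elt r l =
    if erange e == esource (r 0%N) then path_elt (scons e r) l.+1 else 0.
Proof.
rewrite -[ed e]edge_rangeM -rngmulA vertex_pathM; case: eqP => _ //=.
exact: rngmulr0.
Qed.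

Lemma ghost_pathM e r l : infinite_path r ->
  gh e ** path_elt r l.+1 = if e == r 0%N then path_elt (tail 1 r) l else 0.
Proof.
move=> hr /=; rewrite rngmulA ghost_edgeM; case: eqP => [->|_].
  by rewrite vertex_pathM hr eqxx.
exact: rngmul0r.
Qed.

Lemma path_eltD r l k : infinite_path r ->
  path_elt r (l + k) = path_elt r l ** path_elt (tail l r) k.
Proof.
elim: l r => [|l IH] r hr /=; first by rewrite vertex_pathM eqxx.
by rewrite IH ?tailD ?rngmulA //; apply: infinite_path_tail.
Qed.

Lemma ghost_path_pathM r l : infinite_path r ->
  ghost_path_elt r l ** path_elt r l = vx (esource (r l)).
Proof.
elim: l r => [|l IH] r hr; first by rewrite /= vertexM eqxx.
rewrite [ghost_path_elt _ _]/= -rngmulA ghost_pathM // eqxx IH //.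
exact: infinite_path_tail.
Qed.

(** Without bifurcations every factor [e e^*] in the middle of the product is the
   source of [e]. *)
Lemma path_ghost_pathM r l : infinite_path r ->
  (forall k, ~ bifurcation (esource (r k))) ->
  path_elt r l ** ghost_path_elt r l = vx (esource (r 0%N)).
Proof.
elim: l r => [|l IH] r hr nb /=; first by rewrite vertexM eqxx.
rewrite rngmulA -[_ ** ghost_path_elt _ _]rngmulA IH; last 2 first.
- exact: infinite_path_tail.
- by move=> k; apply: (nb k.+1).
rewrite /tail -hr edge_rangeM edge_ghost_single //.
apply/seteqP; split=> [e he|e ->] //=.
by apply: contrapT => ne; case: (nb 0%N); exists e, (r 0%N).
Qed.

Lemma act_ghost_path p (q q' : tail_path p) l : tail l (val q) = val q' ->
  act (ghost_path_elt (val q) l) (chen_basis K q) = chen_basis K q'.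
Proof.
elim: l q => [|l IH] q /= qq'.
  by rewrite chen_act_vert /chen_vert eqxx; congr chen_basis; apply: val_inj.
rewrite actA chen_act_ghost /chen_ghost eqxx.
by rewrite -[tail 1 _]/(val (cls_behead q)) IH //= tailD.
Qed.

Lemma act_path p (q q' : tail_path p) l : tail l (val q) = val q' ->
  act (path_elt (val q) l) (chen_basis K q') = chen_basis K q.
Proof.
elim: l q => [|l IH] q /= qq'.
  have -> : q' = q by apply: val_inj.
  by rewrite chen_act_vert /chen_vert eqxx.
rewrite actA -[tail 1 _]/(val (cls_behead q)) IH /= ?tailD //.
by rewrite chen_act_edge (chen_edge1 K (cls_range q)) cls_sconsK.
Qed.

End Segments.

(** * The Chen module as a direct limit *)

Section Truncation.
Variables (K : fieldType) (E : digraph) (p : nat -> edge E).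
Hypotheses (hp : infinite_path p) (irr : ~ rational p).
Local Notation cls := (tail_path p).
Local Notation L := (leavitt K E).
Implicit Types (r : cls) (n l : nat).

(** The segment of [r] before the point where it joins [tau^(>n)(p)]; such a
   point exists for all large [n]. *)
Definition truncate n r : L :=
  if pselect (exists l, tail l (val r) = tail n p) is left h
  then path_elt K (val r) (sval (cid h)) else 0.

Lemma truncateE n r l :
  tail l (val r) = tail n p -> truncate n r = path_elt K (val r) l.
Proof.
move=> hl; rewrite /truncate; case: pselect => [h|[]]; last by exists l.
by congr path_elt; apply: irrational_tail_inj hp irr (svalP (cid h)) hl.
Qed.

Definition truncation n (m : chen K p) : L := fglift (truncate n) m.

Lemma truncationU n r : truncation n (chen_basis K r) = truncate n r.
Proof. by rewrite /truncation /chen_basis liftU scale1r. Qed.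

Fact truncation_linear n : linear (truncation n).
Proof.
have fB : zmod_morphism (truncation n) by exact: lift_is_additive.
have f0 : truncation n 0 = 0 by have := fB 0 0; rewrite !subrr.
have fD : {morph truncation n : x y / x + y}.
  by move=> x y; rewrite -{1}[y]opprK fB -(sub0r y) fB f0 sub0r opprK.
move=> k x y; rewrite fD; congr (_ + _).
rewrite (chen_sumE x) scaler_sumr !(big_morph _ fD f0) scaler_sumr.
apply: eq_bigr => q _; rewrite scalerA -!freeg_scaleU.
by rewrite /truncation !liftU scalerA.
Qed.

HB.instance Definition _ n :=
  GRing.isLinear.Build K (chen K p) L *:%R (truncation n) (truncation_linear n).

(** The truncations of [r] eventually have positive length, so that [e^*] can strip
   off their first edge. *)
Lemma eventually_truncated r : exists n0, forall n, (n0 <= n)%N ->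
  exists l, tail l.+1 (val r) = tail n p.
Proof.
have [_ [m [l [_ l0 ml]]]] := set_mem (valP r).
exists m => n mn; exists (l.-1 + (n - m))%N.
by rewrite -addSn prednK // -tailD -(funext ml) tailD subnKC.
Qed.

Lemma truncation_act_linear (a : L) :
  (forall r, exists n0, forall n, (n0 <= n)%N ->
    truncation n (act a (chen_basis K r)) =
      a ** truncation n (chen_basis K r)) ->
  forall m : chen K p, exists n0, forall n, (n0 <= n)%N ->
    truncation n (act a m) = a ** truncation n m.
Proof.
move=> ha m; rewrite (chen_sumE m); elim: (dom m) => [|r s [n1 IH]].
  by exists 0%N => n _; rewrite big_nil act0r linear0 rngmulr0.
have [n2 hn2] := ha r; exists (maxn n1 n2) => n.
rewrite geq_max => /andP[h1 h2].
rewrite big_cons actDr !linearD /= IH // rngmulDr; congr (_ + _).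
rewrite [act a _](_ : _ = coeff r m *: act a (chen_basis K r)).
  by rewrite !linearZ /= hn2 // leavitt_scaleAr.
exact: linearZ.
Qed.

(** On a basis vector, [v], [e] and [e^*] act on the first edge of a path only,
   which truncation does not touch once it keeps at least one edge; sums and
   products of elements need only a larger [n]. *)
Lemma truncation_act (a : L) (m : chen K p) :
  exists n0, forall n, (n0 <= n)%N ->
    truncation n (act a m) = a ** truncation n m.
Proof.
elim/leavitt_linear_ind: a m => [v|e|e||a IH|a b IHa IHb|k a IH|a b IHa IHb] m.
- apply: truncation_act_linear => {m} r.
  have [n0 lev] := eventually_truncated r; exists n0 => n /lev[l hl].
  rewrite chen_act_vert /chen_vert truncationU (truncateE hl) vertex_pathM.
  rewrite eq_sym.
  by case: ifP; rewrite ?linear0 // truncationU (truncateE hl).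
- apply: truncation_act_linear => {m} r.
  have [n0 lev] := eventually_truncated r; exists n0 => n /lev[l hl].
  rewrite chen_act_edge truncationU (truncateE hl) edge_pathM eq_sym.
  case: eqP => h; last by rewrite chen_edge0 // linear0.
  by rewrite (chen_edge1 K h) truncationU (@truncateE n _ l.+2).
- apply: truncation_act_linear => {m} r.
  have [n0 lev] := eventually_truncated r; exists n0 => n /lev[l hl].
  have hr : infinite_path (val r) by have [] := set_mem (valP r).
  rewrite chen_act_ghost truncationU (truncateE hl) /chen_ghost ghost_pathM //.
  rewrite eq_sym; case: eqP => _; last by rewrite linear0.
  by rewrite truncationU (@truncateE n _ l) //= tailD.
- by exists 0%N => n _; rewrite act0l linear0 rngmul0r.
- have [n0 hn0] := IH m; exists n0 => n /hn0.
  by rewrite actNl rngmulNr linearN /= => ->.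
- have [n1 h1] := IHa m; have [n2 h2] := IHb m.
  exists (maxn n1 n2) => n; rewrite geq_max => /andP[/h1 e1 /h2 e2].
  by rewrite actDl linearD /= e1 e2 rngmulDl.
- have [n0 hn0] := IH m; exists n0 => n /hn0 e.
  by rewrite chen_actZ linearZ /= e leavitt_scaleAl.
- have [n1 h1] := IHa (act b m); have [n2 h2] := IHb m.
  exists (maxn n1 n2) => n; rewrite geq_max => /andP[/h1 e1 /h2 e2].
  by rewrite actA e1 e2 rngmulA.
Qed.

(** If [a r = 0] then [a] kills a truncation of [r] by [truncation_act], hence
   also all longer segments. *)
Lemma annihilator_segment (a : L) r : act a (chen_basis K r) = 0 ->
  exists l0, forall l, (l0 <= l)%N -> a ** path_elt K (val r) l = 0.
Proof.
move=> ar; have [n1 h1] := truncation_act a (chen_basis K r).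
have [n2 lev] := eventually_truncated r.
have [l0 hl0] := lev _ (leq_maxr n1 n2); exists l0.+1 => l /subnKC <-.
have hr : infinite_path (val r) by have [] := set_mem (valP r).
have := h1 _ (leq_maxl n1 n2).
rewrite ar linear0 truncationU (truncateE hl0) => e.
by rewrite path_eltD // rngmulA -e rngmul0r.
Qed.

End Truncation.

(** * Line points and the Chen module *)

Section LinePoints.
Variable E : digraph.
Implicit Types p : nat -> edge E.

Lemma out_edge_unique p k (e : edge E) : ~ bifurcation (esource (p k)) ->
  esource e = esource (p k) -> e = p k.
Proof. by move=> nb ek; apply: contrapT => ne; case: nb; exists e, (p k). Qed.

Lemma is_path_no_bifurcation p n k w c : infinite_path p ->
  (forall k, (n <= k)%N -> ~ bifurcation (esource (p k))) -> (n <= k)%N ->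
  is_path (esource (p k)) c w -> w = esource (p (k + size c)%N).
Proof.
move=> hp nb; elim: c k => [|e c IH] k nk /=; first by rewrite addn0.
move=> [/(out_edge_unique (nb k nk)) ->]; rewrite hp => /IH ->.
  by rewrite addSnnS.
exact: leqW.
Qed.

Lemma tail_eq_no_bifurcation p n k l : infinite_path p ->
  (forall k, (n <= k)%N -> ~ bifurcation (esource (p k))) -> (n <= k)%N ->
  esource (p l) = esource (p k) -> tail l p = tail k p.
Proof.
move=> hp nb nk lk; apply/funext; elim=> [|i IH] /=.
  by rewrite /tail !addn0; apply: out_edge_unique => //; exact: nb.
rewrite /tail !addnS; apply: out_edge_unique.
  by apply: nb; rewrite -addnS (leq_trans nk) ?leq_addr.
by rewrite -!hp; congr erange.
Qed.

(** Paths from the [n]-th vertex follow [p], so a cycle met there would make two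
   different tails of [p] equal. *)
Lemma no_bifurcation_line_point p n : infinite_path p -> ~ rational p ->
  (forall k, (n <= k)%N -> ~ bifurcation (esource (p k))) ->
  line_point (esource (p n)).
Proof.
move=> hp irr nb w [c /(is_path_no_bifurcation hp nb (leqnn n)) ->].
have nc : (n <= n + size c)%N := leq_addr _ _.
split; first exact: nb.
case=> d [[d0 /(is_path_no_bifurcation hp nb nc) wE] _].
have /(irrational_tail_inj hp irr) := tail_eq_no_bifurcation hp nb nc (esym wE).
move=> /(_ _ erefl)/eqP; rewrite -[X in _ == X]addn0 eqn_add2l => /nilP.
exact: d0.
Qed.

Lemma line_point_no_bifurcation p n : infinite_path p ->
  line_point (esource (p n)) -> forall k, ~ bifurcation (esource (tail n p k)).
Proof.
move=> hp lp k; apply: (proj1 (lp _ _)).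
by exists (mkseq (tail n p) k); exact: is_path_segment.
Qed.

End LinePoints.

Section ChenModule.
Variables (K : fieldType) (E : digraph) (p : nat -> edge E).
Hypothesis hp : infinite_path p.
Local Notation L := (leavitt K E).
Local Notation V := (chen K p).

Lemma tail_class_tail n : tail n p \in tail_class p.
Proof.
apply/mem_set; split; first exact: infinite_path_tail.
by exists n.+1, 1%N; split=> // i; rewrite /tail addSnnS.
Qed.

Definition tail_cls n : tail_path p := exist _ (tail n p) (tail_class_tail n).

(** Two tail-equivalent paths differ by finite segments: strip one off with ghost
   edges and put the other one on. *)
Lemma chen_cyclic (q : tail_path p) (m : V) :
  exists a : L, act a (chen_basis K q) = m.
Proof.
rewrite (chen_sumE m); elim: (dom m) => [|r s [a IH]].
  by exists 0; rewrite act0l big_nil.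
have [b rb] : exists b : L, act b (chen_basis K q) = chen_basis K r.
  have [_ [n1 [l1 [_ _ e1]]]] := set_mem (valP q).
  have [_ [n2 [l2 [_ _ e2]]]] := set_mem (valP r).
  exists (path_elt K (val r) (l2 + n1) ** ghost_path_elt K (val q) (l1 + n2)).
  rewrite actA (@act_ghost_path _ _ _ _ (tail_cls (n1 + n2))) ?act_path //=.
    by rewrite -tailD -(funext e2) tailD addnC.
  by rewrite -tailD -(funext e1) tailD.
exists (coeff r m *: b + a); rewrite actDl IH big_cons; congr (_ + _).
by rewrite -rb; exact: chen_actZ.
Qed.

Lemma chen_finitely_generated : finitely_generated V.
Proof.
exists 1%N, (fun=> chen_basis K (tail_cls 0)) => m.
have [a <-] := chen_cyclic (tail_cls 0) m.
by exists (fun=> a); rewrite big_ord1.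
Qed.

Lemma orbit_map_is_hom (M : umodType L) (x : M) : is_hom (fun a : L => act a x).
Proof. by split=> [a b|a b]; rewrite ?actDl ?actA. Qed.

Hypothesis irr : ~ rational p.

(** Injectivity of the map [a |-> a q] from [L w] to [V], where [w] is the line
   point and [q] the tail of [p] starting at [w]. *)
Lemma line_point_annihilator n (a : L) : line_point (esource (p n)) ->
  act a (chen_basis K (tail_cls n)) = 0 ->
  a ** vertex_elt K (esource (p n)) = 0.
Proof.
move=> /(line_point_no_bifurcation hp) nb.
move=> /(annihilator_segment hp irr)[l /(_ l (leqnn l))] /= al.
have := path_ghost_pathM K l (infinite_path_tail n hp) nb.
rewrite /tail addn0 => <-.
by rewrite rngmulA al rngmul0r.
Qed.

(** [V] behaves as [L w]: if [g x = f q], then sending [a q] to [a w x] is well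
   defined by [line_point_annihilator] and lifts [f] through [g]. *)
Lemma line_point_projective n : line_point (esource (p n)) -> projective V.
Proof.
move=> lp M M' g f gh gsurj fh.
set q := chen_basis K (tail_cls n); set w := vertex_elt K (esource (p n)).
have wq : act w q = q by rewrite chen_act_vert /chen_vert /= /tail addn0 eqxx.
have [x gx] := gsurj (f q).
have [s sP] := choice (chen_cyclic (tail_cls n)).
have actw a b : act a q = act b q -> act a (act w x) = act b (act w x).
  move=> ab; apply/eqP; rewrite -!actA -subr_eq0 -actNl -actDl -rngmulBl.
  by rewrite (line_point_annihilator lp) ?act0l // actDl actNl ab subrr.
exists (fun m => act (s m) (act w x)); split; first split.
- by move=> m m'; rewrite -actDl; apply: actw; rewrite actDl !sP.
- by move=> a m; rewrite -[RHS]actA; apply: actw; rewrite actA !sP.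
by move=> m; rewrite !gh.2 gx -!fh.2 wq sP.
Qed.

(** The annihilator of [p] is the increasing union over [n] of the annihilators
   of the segments of length [n]; finite presentation makes it stop growing. *)
Lemma finitely_presented_annihilator : finitely_presented V ->
  exists n, forall a : L, act a (chen_basis K (tail_cls 0)) = 0 ->
    a ** path_elt K p n = 0.
Proof.
move=> [P [N [_ prP [d [x [xN xgen]]] [f [fh [f' fK f'K]]]]]].
set q := chen_basis K (tail_cls 0).
have f'h : is_hom f'.
  split=> [y z|a y]; apply: (can_inj fK).
    by rewrite fh.1 !f'K.
  by rewrite fh.2 !f'K.
pose phi y := f' (quot_proj N y).
have phi_h : is_hom phi.
  split=> [y z|a y]; rewrite /phi; first by rewrite quot_projD f'h.1.
  by rewrite -quot_actE -f'h.2.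
have phi0 y : phi y = 0 <-> y \in (N : {pred P}).
  have projh : is_hom (quot_proj N).
    by split=> [z z'|a z]; [exact: quot_projD | rewrite -quot_actE].
  rewrite -{2}[y]subr0 -quot_projP (is_hom0 projh).
  split=> [|e]; last by rewrite /phi e (is_hom0 f'h).
  by rewrite -(is_hom0 f'h) => /(can_inj f'K).
have [h [hh hphi]] := prP L V (fun a => act a q) phi (orbit_map_is_hom q)
  (chen_cyclic (tail_cls 0)) phi_h.
pose x0 := quot_repr (f q).
have phix0 : phi x0 = q by rewrite /phi quot_reprK fK.
pose w := vertex_elt K (esource (p 0%N)).
have wq : act w q = q by rewrite chen_act_vert /chen_vert eqxx.
have [n0 hn0] : exists n0, forall n, (n0 <= n)%N ->
    (h x0 - w) ** path_elt K p n = 0.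
  apply: (annihilator_segment hp irr (r := tail_cls 0)).
  by rewrite actDl actNl wq hphi phix0 subrr.
have /choice[ni hni] (i : 'I_d) : exists ni, forall n, (ni <= n)%N ->
    h (x i) ** path_elt K p n = 0.
  apply: (annihilator_segment hp irr (r := tail_cls 0)).
  by rewrite hphi; apply/phi0.
exists (maxn n0 (\max_i ni i)) => a aq; set n := maxn _ _.
have pn : h x0 ** path_elt K p n = path_elt K p n.
  have /eqP := hn0 n (leq_maxl _ _).
  by rewrite rngmulBl vertex_pathM eqxx subr_eq0 => /eqP.
(* [a x0] is in [N], so its lift is a combination of lifts that kill [p_n]. *)
have /phi0/xgen[b abx] : phi (act a x0) = 0 by rewrite phi_h.2 phix0.
have := congr1 h abx; rewrite hh.2 (is_hom_sum _ _ hh) => ahx.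
rewrite -pn rngmulA [_ ** h x0]ahx rngmul_sumlA big1 // => i _.
by rewrite hni ?rngmulr0 // leq_max (leq_bigmax i) orbT.
Qed.

Lemma annihilator_no_bifurcation n :
  (forall a : L, act a (chen_basis K (tail_cls 0)) = 0 ->
    a ** path_elt K p n = 0) ->
  forall k, (n <= k)%N -> ~ bifurcation (esource (p k)).
Proof.
move=> ann k nk bif.
have [f [fk fp]] : exists f, esource f = esource (p k) /\ f <> p k.
  have [e [f [ek fk ef]]] := bif.
  have [epk|] := pselect (e = p k); last by exists e.
  by exists f; split=> //; rewrite -epk => /esym.
(* [a] kills [p], which continues with [p k] and not with [f], but not [p_k f]. *)
pose a := ghost_elt K f ** ghost_path_elt K p k.
have /ann apn : act a (chen_basis K (tail_cls 0)) = 0.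
  rewrite actA (@act_ghost_path _ _ _ (tail_cls 0) (tail_cls k)) //.
  rewrite chen_act_ghost /chen_ghost /= /tail addn0.
  by case: eqP => // pf; case: fp.
apply: (@vertex_elt_neq0 K E (erange f)).
have fkE : ghost_elt K f ** vertex_elt K (esource (p k)) = ghost_elt K f.
  by rewrite -fk ghost_sourceM.
have := ghost_edgeM K f f.
rewrite eqxx -{1}fkE -(ghost_path_pathM K k hp) => <-.
by rewrite rngmulA -/a -(subnKC nk) path_eltD // rngmulA apn !rngmul0r.
Qed.

End ChenModule.

Theorem theorem4p6 (K : fieldType) (E : digraph) (p : nat -> edge E)
    (hp : infinite_path p) (hirr : ~ rational p) :
  [<-> finitely_presented (chen K p);
       projective (chen K p);
       exists i : nat, line_point (esource (p i))].
Proof.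
have line_projective i : line_point (esource (p i)) -> projective (chen K p).
  exact: line_point_projective.
have fp_line : finitely_presented (chen K p) ->
    exists i, line_point (esource (p i)).
  move=> /(finitely_presented_annihilator hp hirr)[n ann]; exists n.
  exact/no_bifurcation_line_point/(annihilator_no_bifurcation ann).
have projective_fp : projective (chen K p) -> finitely_presented (chen K p).
  exact/finitely_presented_projective/chen_finitely_generated.
tfae.
- by move=> /fp_line[i /line_projective].
- by move=> /projective_fp/fp_line.
- by move=> [i /line_projective/projective_fp].
Qed.
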